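(* Let $n\ge 3$. There exists a linear $DPL(n,6)$ code if and only if there exist a finite abelian group $H$ (written multiplicatively, identity $e$) of order $2n^2+1$ and a subset $T\subseteq H$ such that (1) $|T|=2n$; (2) $T=T^{(-1)}$; (3) $T^2=2H-T^{(2)}+(2n-2)e$ in the group ring $\mathbb{Z}[H]$.
   Context: Lee distance on $\mathbb{Z}^n$: $d_L(u,v)=\sum_i|u_i-v_i|$. A $DPL(n,d)$ code is a set $C\subseteq\mathbb{Z}^n$ with $d_L(u,v)\ge d$ for all distinct $u,v\in C$, such that there is a partition $\{W_i\}$ of $\mathbb{Z}^n$ into sets each of which is a diameter $d-1$ anticode (all pairwise Lee distances $\le d-1$) of maximum possible cardinality, with $|C\cap W_i|=1$ for all $i$ and $C\cap W_i\ne C\cap W_j$ for $i\neq j$; it is linear if $C$ is a subgroup of $\mathbb{Z}^n$. In $\mathbb{Z}[H]$ a subset $A\subseteq H$ is identified with $\sum_{g\in A}g$ (so $H$ denotes the sum of all group elements), products are group ring products, and for $A=\sum a_g g$ and $t\in\mathbb{Z}$, $A^{(t)}=\sum a_g g^t$. *)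

(* Defs.v *)
From HB Require Import structures.
From mathcomp Require Import all_boot all_order all_algebra all_fingroup.
From mathcomp Require Import classical_sets cardinality.

Set Implicit Arguments.
Unset Strict Implicit.
Unset Printing Implicit Defensive.

Import Order.TTheory GRing.Theory Num.Theory.

Local Open Scope classical_set_scope.
Local Open Scope card_scope.
Local Open Scope ring_scope.

Section Lee.
Variable n : nat.
Implicit Types (C A W : set 'rV[int]_n) (d : nat).

Definition lee_dist (u v : 'rV[int]_n) : nat :=
  (\sum_(i < n) `|u ord0 i - v ord0 i|)%N.

Definition anticode (D : nat) A :=
  forall u v, A u -> A v -> (lee_dist u v <= D)%N.

Definition max_anticode (D : nat) W :=
  anticode D W /\ forall A, anticode D A -> A #<= W.

(* The conditions on W force distinct indices to have distinct parts, so
   a family indexed by I is the same as a set of parts. *)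
Definition DPL_code d C :=
  (forall u v, C u -> C v -> u <> v -> (d <= lee_dist u v)%N) /\
  exists (I : Type) (W : I -> set 'rV[int]_n),
    [/\ partition [set: I] W [set: 'rV[int]_n],
        forall i, max_anticode d.-1 (W i),
        forall i, C `&` W i #= `I_1
      & forall i j, i <> j -> C `&` W i <> C `&` W j].

Definition linear_code C := zmod_closed [in C].

End Lee.

(* The integral group ring of a finite group, with coefficient functions as
   carrier; it is an alias so that its product is the convolution and not the
   pointwise product of {ffun gT -> int}. *)
Definition group_ring (gT : finGroupType) : Type := {ffun gT -> int}.

HB.instance Definition _ (gT : finGroupType) :=
  GRing.Zmodule.copy (group_ring gT) {ffun gT -> int}.

Section GroupRing.
Variable gT : finGroupType.
Implicit Types (a b c : group_ring gT) (g h k : gT).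

Definition gr_elt g : group_ring gT := [ffun h => (h == g)%:R : int].

Definition gr_mul a b : group_ring gT :=
  [ffun k => \sum_g a g * b (g^-1 * k)%g].

Fact gr_mulA : associative gr_mul.
Proof.
move=> a b c; apply/ffunP => k; rewrite !ffunE.
under eq_bigr => g _ do rewrite ffunE mulr_sumr.
under [RHS]eq_bigr => h _ do rewrite ffunE mulr_suml.
rewrite [RHS]exchange_big /=; apply: eq_bigr => g _.
rewrite (reindex_inj (mulgI g^-1%g)) /=; apply: eq_bigr => h _.
by rewrite mulrA invMg invgK -!mulgA mulKVg.
Qed.

Fact gr_mul1 : left_id (gr_elt 1%g) gr_mul.
Proof.
move=> a; apply/ffunP => k; rewrite !ffunE (bigD1 1%g) //= ffunE eqxx mul1r.
rewrite invg1 mul1g big1 ?addr0 // => g /negPf ng1.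
by rewrite ffunE ng1 mul0r.
Qed.

Fact gr_mulr1 : right_id (gr_elt 1%g) gr_mul.
Proof.
move=> a; apply/ffunP => k; rewrite !ffunE (bigD1 k) //= ffunE mulVg eqxx mulr1.
rewrite big1 ?addr0 // => g ngk.
by rewrite ffunE -eq_invg_mul invgK (negPf ngk) mulr0.
Qed.

Fact gr_mulDl : left_distributive gr_mul +%R.
Proof.
move=> a b c; apply/ffunP => k; rewrite !ffunE -big_split /=.
by apply: eq_bigr => g _; rewrite ffunE mulrDl.
Qed.

Fact gr_mulDr : right_distributive gr_mul +%R.
Proof.
move=> a b c; apply/ffunP => k; rewrite !ffunE -big_split /=.
by apply: eq_bigr => g _; rewrite ffunE mulrDr.
Qed.

Fact gr_oner_neq0 : gr_elt 1%g != 0.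
Proof. by apply/eqP => /ffunP/(_ 1%g); rewrite !ffunE eqxx. Qed.

HB.instance Definition _ := GRing.Zmodule_isNzRing.Build (group_ring gT)
  gr_mulA gr_mul1 gr_mulr1 gr_mulDl gr_mulDr gr_oner_neq0.

Definition gr_set (A : {set gT}) : group_ring gT := \sum_(g in A) gr_elt g.

Definition expgz g (t : int) : gT :=
  match t with Posz m => g ^+ m | Negz m => g ^- m.+1 end%g.

Definition gr_pow a (t : int) : group_ring gT :=
  \sum_g gr_elt (expgz g t) *~ a g.

End GroupRing.

(* Main.v *)
(** Anticodes of diameter 5 have at most 4n^2+2 points. Slice a set A along one
    coordinate and let B_k be the set of points of Z^(n-1) whose fibre has more
    than k elements, so that |A| is the sum of the |B_k|; two fibres of sizes
    j+1 and k+1 contain points at distance at least (j+k)/2, so the distances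
    between B_j and B_k are at most D - (j+k)/2. When D - k is odd, exchanging
    the odd parts of B_k and B_(k+1) produces two anticodes of diameter
    D - k - 1, and the bounds for D = 0, 2, 4, 5 follow by induction on n.

    Let E be the set of the 2n^2+1 even vectors of weight at most 2. For each
    signed unit vector u, the union of E and E + u is an anticode of diameter 5,
    and it has 4n^2+2 points.

    From a code C to a group: comparing the number of points of C in growing
    boxes, the index of C is at most 4n^2+2, so each union of E and E + u is a
    transversal of C. Hence v is in E + C iff v - u is not, for every u, which
    makes E a transversal of C in the even vectors. These form a quotient of odd
    order m = 2n^2+1, and K = {x | (m+1) x in C} extends C to a subgroup of Z^n
    with transversal E: take H = Z^n / K and T the image of the unit vectors.

    From a group to a code: read coefficientwise, the equation for T^2 says that
    the unordered pairs in T with product different from 1 represent every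
    element different from 1 exactly once. Writing T = {h_i, h_i^-1}, the even
    vectors in the kernel of e_i |-> h_i form the code; its minimum distance is 6
    and the translates of the union of E and E + e_1 tile the space. An anticode
    of diameter 5 injects into Z^n / C, so these tiles are maximum. *)
From HB Require Import structures.
Require Import Defs.
From mathcomp Require Import all_boot all_order all_algebra all_fingroup.
From mathcomp Require Import boolp classical_sets cardinality.
From mathcomp Require Import zify.

Set Implicit Arguments.
Unset Strict Implicit.
Unset Printing Implicit Defensive.

Import Order.TTheory GRing.Theory Num.Theory.

(** * Anticodes of diameter 5 *)

(** Points are lists of coordinates here, so that lowering the dimension is removing the head. *)
Fixpoint ldist (u v : seq int) : nat :=
  match u, v with
  | x :: u', y :: v' => `|x - y| + ldist u' v'
  | _, _ => 0
  end.

Definition lodd (u : seq int) : bool := odd (sumn [seq `|x| | x <- u]).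

Lemma odd_absz_sub (x y : int) : odd `|x - y| = odd `|x| (+) odd `|y|.
Proof. lia. Qed.

Lemma odd_ldist u v :
  size u = size v -> odd (ldist u v) = lodd u (+) lodd v.
Proof.
rewrite /lodd; elim: u v => [|x u IHu] [|y v] //= [suv].
by rewrite !oddD odd_absz_sub (IHu _ suv) addbACA.
Qed.

Lemma ldistC u v : ldist u v = ldist v u.
Proof. by elim: u v => [|x u IHu] [|y v] //=; rewrite IHu distnC. Qed.

Lemma ldist_eq0 u v : size u = size v -> ldist u v = 0 -> u = v.
Proof.
elim: u v => [|x u IHu] [|y v] //= [suv] /eqP; rewrite addn_eq0.
by case/andP=> xy /eqP /(IHu _ suv) ->; congr cons; lia.
Qed.

(** Once sorted, distinct integers rise by at least 1 per step, so entry [j] exceeds entry 0 by at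
    least [j]. *)
Lemma uniq_int_spread (F : seq int) j :
  uniq F -> j < size F ->
  exists a b : int, [/\ a \in F, b \in F & (j%:Z <= a - b)%R].
Proof.
move=> uF jF; set s : seq int := sort <=%R F.
have ss : sorted <%R s.
  by rewrite lt_sorted_uniq_le sort_uniq uF sort_le_sorted.
have step (i : nat) : i < size s -> (i%:Z <= nth 0 s i - nth 0 s 0)%R.
  elim: i => [|i IHi] si; first by rewrite subrr.
  have lt_i : (nth 0 s i < nth 0 s i.+1 :> int)%R.
    exact: (sorted_ltn_nth lt_trans 0%R ss i i.+1 (ltnW si) si (ltnSn i)).
  have := IHi (ltnW si); move: lt_i.
  move: (nth 0%R s i) (nth 0%R s i.+1) (nth 0%R s 0) => a b c; lia.
have js : j < size s by rewrite size_sort.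
exists (nth 0%R s j), (nth 0%R s 0); split; last exact: step.
  by rewrite -(mem_sort <=%R) mem_nth.
by rewrite -(mem_sort <=%R) mem_nth // (leq_ltn_trans _ js).
Qed.

Definition diam_le n D V := forall s : seq (seq int),
  uniq s -> {in s, forall u, size u = n} ->
  {in s &, forall u v, ldist u v <= D} -> size s <= V.

Lemma diam_leq n D V V' : V <= V' -> diam_le n D V -> diam_le n D V'.
Proof. by move=> leV H s us ss ds; apply: leq_trans leV; apply: H. Qed.

Lemma diam_le_dim0 D : diam_le 0 D 1.
Proof.
move=> s us ss _; apply: (@uniq_leq_size _ s [:: [::]]) => // u /ss.
by move/size0nil ->.
Qed.

(* Recombining the even part of one set with the odd part of the other turns
   the two sets into two sets of diameter D. *)
Lemma diam_le_swap n D V (P Q : seq (seq int)) :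
  ~~ odd D -> diam_le n D V -> uniq P -> uniq Q -> {subset Q <= P} ->
  {in P, forall u, size u = n} ->
  {in P &, forall u v, ldist u v <= D.+1} ->
  {in P & Q, forall u v, ldist u v <= D} ->
  size P + size Q <= V + V.
Proof.
move=> evD dV uP uQ QP sP dP dPQ.
have mixed b : size [seq u <- P | b (+) lodd u]
                 + size [seq u <- Q | ~~ b (+) lodd u] <= V.
  rewrite -size_cat; apply: dV => [|u|u v].
  - rewrite cat_uniq !filter_uniq //= andbT; apply/hasPn => u.
    by rewrite !mem_filter => /andP[+ _]; case: b (lodd u) => [] [].
  - by rewrite mem_cat !mem_filter => /orP[/andP[_ /sP]//|/andP[_ /QP/sP]].
  (* Points of equal parity are at even distance, while [D.+1] is odd, so the bound drops to [D]. *)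
  have evenD u' v' : u' \in P -> v' \in P -> lodd u' = lodd v' ->
      ldist u' v' <= D.
    move=> u'P v'P par; move: (dP _ _ u'P v'P).
    rewrite leq_eqVlt => /orP[/eqP e|//].
    have := odd_ldist (etrans (sP _ u'P) (esym (sP _ v'P))).
    by rewrite e /= par addbb (negbTE evD).
  rewrite !mem_cat !mem_filter.
  move=> /orP[] /andP[pu mu] /orP[] /andP[pv mv].
  - by apply: evenD => //; move: pu pv; case: b; case: (lodd u); case: (lodd v).
  - exact: dPQ.
  - by rewrite ldistC; apply: dPQ.
  - apply: evenD; [exact: QP|exact: QP|].
    by move: pu pv; case: b; case: (lodd u); case: (lodd v).
have split (R : seq (seq int)) :
    size [seq u <- R | ~~ lodd u] + size [seq u <- R | lodd u] = size R.
  by rewrite !size_filter addnC -[RHS](count_predC lodd).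
have := mixed true; have := mixed false; rewrite /=.
by move: (split P) (split Q); lia.
Qed.

(** * Slicing an anticode along its first coordinate *)

Section Layers.
Variables (n D : nat) (s : seq (seq int)).
Hypotheses (us : uniq s) (ss : {in s, forall u, size u = n.+1}).
Hypothesis ds : {in s &, forall u v, ldist u v <= D}.

Let cnt y := count (fun x => behead x == y) s.

(** This is the set B_k; [undup] is there because a tail occurs once for each point of its fibre. *)
Definition layer k := [seq y <- undup (map behead s) | k < cnt y].

Lemma layer_uniq k : uniq (layer k).
Proof. by rewrite filter_uniq // undup_uniq. Qed.

Lemma layer_size k : {in layer k, forall u, size u = n}.
Proof.
move=> u; rewrite mem_filter mem_undup => /andP[_ /mapP[x /ss sx ->]].
by rewrite size_behead sx.
Qed.

Lemma layer_sub k : {subset layer k.+1 <= layer k}.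
Proof. by move=> u; rewrite !mem_filter => /andP[/ltnW -> ->]. Qed.

Lemma layer_fiber k y : y \in layer k ->
  exists a b : int, [/\ a :: y \in s, b :: y \in s & (k%:Z <= a - b)%R].
Proof.
rewrite mem_filter => /andP[ky _].
pose F := [seq head 0%R x | x <- s & behead x == y].
have fibE x : x \in s -> behead x == y -> x = head 0%R x :: y.
  by move=> /ss; case: x => //= a x _ /eqP ->.
have uF : uniq F.
  rewrite map_inj_in_uniq ?filter_uniq // => x x'.
  rewrite !mem_filter => /andP[xy xs] /andP[x'y x's] e.
  by rewrite (fibE _ xs xy) (fibE _ x's x'y) e.
have Fs a : a \in F -> a :: y \in s.
  by case/mapP=> x; rewrite mem_filter => /andP[xy xs] ->; rewrite -fibE.
have [|a [b [/Fs aF /Fs bF ab]]] := @uniq_int_spread F k uF.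
  by rewrite size_map size_filter.
by exists a, b.
Qed.

(** Take a - b >= j in the fibre of [y] and c - d >= k in that of [z]. Then |a - d| + |b - c| >= j +
    k, and the claim is the sum of the distance bounds for the pairs with heads a, d and b, c. *)
Lemma layer_dist j k : {in layer j & layer k, forall y z,
  2 * ldist y z + (j + k) <= 2 * D}.
Proof.
move=> y z /layer_fiber[a [b [ay bys ab]]] /layer_fiber[c [d [cz dz cd]]].
have /= := ds ay dz; have /= := ds bys cz; lia.
Qed.

Lemma layer0 k : D < k -> layer k = [::].
Proof.
move=> Dk; case E : (layer k) => [//|y l].
have yk : y \in layer k by rewrite E mem_head.
have := layer_dist yk yk; lia.
Qed.

(** Double counting: a tail [y] lies in the layers k < [cnt y], and no fibre has more than [D.+1]
    points, so the layers up to D recover all fibre sizes. *)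
Lemma size_layers : size s = \sum_(k < D.+1) size (layer k).
Proof.
under eq_bigr do rewrite size_filter -sum1_count big_mkcond /=.
rewrite exchange_big /= (eq_big_seq cnt) => [|y ys]; last first.
  have cD : cnt y <= D.+1.
    rewrite leqNgt; apply/negP => Dy.
    suff : y \in layer D.+1 by rewrite layer0.
    by rewrite mem_filter Dy.
  by rewrite -big_mkcond /= (big_ord_narrow cD) sum1_card card_ord.
rewrite -sum1_size.
under [RHS]eq_bigr do rewrite /cnt -sum1_count big_mkcond /=.
rewrite exchange_big /=; apply: eq_big_seq => x xs.
rewrite -big_mkcond sum1_count.
rewrite (eq_count (a2 := pred1 (behead x))) => [|y]; last exact: eq_sym.
by rewrite count_uniq_mem ?undup_uniq // mem_undup map_f.
Qed.

(** Distances are at most D - k inside layer k, and at most D - k - 1/2, hence D - k - 1, between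
    the layers k and k + 1. As D - k - 1 is even, the parity swap applies. *)
Lemma layer_pair k V : k < D -> odd (D - k) -> diam_le n (D - k).-1 V ->
  size (layer k) + size (layer k.+1) <= V + V.
Proof.
move=> kD odk dV; apply: (diam_le_swap _ dV); rewrite ?layer_uniq //.
- by case: (D - k) odk.
- exact: layer_sub.
- exact: layer_size.
- by move=> u v uk vk; have := layer_dist uk vk; lia.
- by move=> u v uk vk; have := layer_dist uk vk; lia.
Qed.

Lemma layer_bot V : diam_le n D V -> size (layer 0) <= V.
Proof.
move=> dV; apply: dV; [exact: layer_uniq|exact: layer_size|].
by move=> u v uk vk; have := layer_dist uk vk; lia.
Qed.

End Layers.

(** * Size bounds for the diameters 0, 2, 4 and 5 *)

Lemma diam_le0 n : diam_le n 0 1.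
Proof.
move=> s us ss ds; case: s us ss ds => // x s us ss ds.
apply: (@uniq_leq_size _ _ [:: x]) => // u uxs; rewrite inE; apply/eqP.
have xs : x \in x :: s := mem_head _ _.
apply: ldist_eq0; first by rewrite !ss.
by apply/eqP; rewrite -leqn0; apply: ds.
Qed.

Lemma diam_le2 n : diam_le n 2 (2 * n + 1).
Proof.
elim: n => [|n IHn]; first exact: diam_le_dim0.
move=> s us ss ds; rewrite (size_layers us ss ds) !big_ord_recr big_ord0 /=.
have := layer_bot us ss ds IHn.
have := @layer_pair _ _ _ us ss ds 1 1 isT isT (@diam_le0 n).
rewrite /=; lia.
Qed.

(** Layer 0 is bounded by induction, layers 1 and 2 through diameter 2, layers 3 and 4 through
    diameter 0. *)
Lemma diam_le4 n : diam_le n 4 (2 * n ^ 2 + 2 * n + 1).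
Proof.
elim: n => [|n IHn]; first exact: diam_le_dim0.
move=> s us ss ds; rewrite (size_layers us ss ds) !big_ord_recr big_ord0 /=.
have := layer_bot us ss ds IHn.
have := @layer_pair _ _ _ us ss ds 1 _ isT isT (@diam_le2 n).
have := @layer_pair _ _ _ us ss ds 3 _ isT isT (@diam_le0 n).
rewrite /= !expnS !expn0; nia.
Qed.

(** For this odd diameter all six layers fall into pairs, bounded through the diameters 4, 2 and 0
    one dimension lower. *)
Lemma diam_le5 n : diam_le n 5 (4 * n ^ 2 + 2).
Proof.
case: n => [|n]; first by apply: diam_leq (@diam_le_dim0 5).
move=> s us ss ds; rewrite (size_layers us ss ds) !big_ord_recr big_ord0 /=.
have := @layer_pair _ _ _ us ss ds 0 _ isT isT (@diam_le4 n).
have := @layer_pair _ _ _ us ss ds 2 _ isT isT (@diam_le2 n).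
have := @layer_pair _ _ _ us ss ds 4 _ isT isT (@diam_le0 n).
rewrite /= !expnS !expn0; nia.
Qed.

Local Open Scope ring_scope.

(** * Weights and unit vectors *)

Section Vectors.
Variable n : nat.
Implicit Types (u v x : 'rV[int]_n) (a b c d : 'I_n * bool).

Definition wt x : nat := (\sum_i `|x ord0 i|)%N.

Lemma lee_distE u v : lee_dist u v = wt (u - v).
Proof. by apply: eq_bigr => i _; rewrite !mxE. Qed.

Lemma anticode5_size (s : seq 'rV[int]_n) :
  uniq s -> {in s &, forall u v, (lee_dist u v <= 5)%N} ->
  (size s <= 4 * n ^ 2 + 2)%N.
Proof.
move=> us ds; pose f v := [seq v ord0 i | i <- enum 'I_n].
have fE u v : ldist (f u) (f v) = lee_dist u v.
  rewrite /lee_dist -big_enum /f /=.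
  by elim: (enum _) => [|i r IHr] /=; rewrite ?big_nil // big_cons IHr.
have f_inj : injective f.
  move=> u v /eq_in_map uv; apply/rowP => i.
  by rewrite -[0](ord1 ord0) uv // mem_enum.
rewrite -(size_map f); apply: diam_le5; first by rewrite map_inj_uniq.
  by move=> _ /mapP[v _ ->]; rewrite size_map size_enum_ord.
by move=> _ _ /mapP[u us' ->] /mapP[v vs ->]; rewrite fE ds.
Qed.

Lemma wt0 : wt 0 = 0%N.
Proof. by rewrite /wt big1 // => i _; rewrite mxE. Qed.

Lemma wt_eq0 x : wt x = 0%N -> x = 0.
Proof.
move/eqP; rewrite sum_nat_eq0 => /forallP x0; apply/rowP => i.
by apply/eqP; have := x0 i; rewrite mxE absz_eq0 (ord1 0).
Qed.

Lemma wtN x : wt (- x) = wt x.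
Proof. by apply: eq_bigr => i _; rewrite mxE abszN. Qed.

Lemma wtD u v : (wt (u + v) <= wt u + wt v)%N.
Proof. by rewrite -big_split; apply: leq_sum => i _; rewrite mxE /=; lia. Qed.

Lemma wtB u v : (wt (u - v) <= wt u + wt v)%N.
Proof. by rewrite -(wtN v) wtD. Qed.

Lemma odd_wtD u v : odd (wt (u + v)) = odd (wt u) (+) odd (wt v).
Proof.
rewrite -oddD -big_split /wt /=; elim/big_rec2: _ => // i k l _ kl.
by rewrite !oddD kl mxE /=; congr addb; lia.
Qed.

Lemma odd_wtB u v : odd (wt (u - v)) = odd (wt u) (+) odd (wt v).
Proof. by rewrite odd_wtD wtN. Qed.

Lemma odd_wt_mulrn k x : odd (wt (x *+ k)) = odd k && odd (wt x).
Proof.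
elim: k => [|k IHk]; first by rewrite mulr0n wt0.
by rewrite mulrS odd_wtD IHk /=; case: (odd k); case: (odd _).
Qed.

Definition unitv a : 'rV[int]_n :=
  \row_j (if j == a.1 then (if a.2 then -1 else 1) else 0).

Definition negu a : 'I_n * bool := (a.1, ~~ a.2).

Lemma unitvN a : unitv (negu a) = - unitv a.
Proof. by apply/rowP => j; rewrite !mxE /=; case: eqP => //; case: a.2. Qed.

Lemma wt_unitv a : wt (unitv a) = 1%N.
Proof.
rewrite /wt (bigD1 a.1) //= big1 => [|j /negbTE ja].
  by rewrite mxE eqxx; case: a.2.
by rewrite mxE ja.
Qed.

Lemma wt_pred x k : wt x = k.+1 -> exists a, wt (x - unitv a) = k.
Proof.
move=> wx; have [i xi|x0] := pickP (fun i => x ord0 i != 0); last first.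
  by move: wx; rewrite /wt big1 // => i _; have /eqP -> := negbFE (x0 i).
(* The unit vector takes the sign of a nonzero coordinate, so subtracting it moves that coordinate
   towards 0. *)
exists (i, x ord0 i < 0); set y := x - _.
have yi : y ord0 i = x ord0 i - (if x ord0 i < 0 then -1 else 1).
  by rewrite !mxE /= eqxx.
have yj j : j != i -> y ord0 j = x ord0 j.
  by move=> /negbTE ji; rewrite !mxE /= ji subr0.
move: wx; rewrite /wt (bigD1 i) //= [in X in _ -> X](bigD1 i) //= yi.
rewrite [in X in _ -> X](eq_bigr _ (fun j ji => congr1 absz (yj j ji))).
move: (\sum_(j < n | j != i) _)%N => S; case: ltP; lia.
Qed.

Lemma wt_le2_even x : (wt x <= 2)%N -> ~~ odd (wt x) -> x != 0 ->
  exists a b, x = unitv a + unitv b.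
Proof.
case wx : (wt x) => [|[|[|//]]] // _ _; first by rewrite (wt_eq0 wx) eqxx.
have [a wa] := wt_pred wx; have [b wb] := wt_pred wa.
exists a, b; apply/eqP; rewrite -subr_eq0 opprD addrA; apply/eqP.
exact: wt_eq0.
Qed.

Lemma unitv_inj : injective unitv.
Proof.
move=> [i s] [j t] /rowP /(_ i); rewrite !mxE /= eqxx.
by case: eqVneq => [->|_]; case: s; case: t.
Qed.

Lemma unitv_add0 a b : unitv a + unitv b = 0 -> b = negu a.
Proof. by move/eqP; rewrite addrC addr_eq0 -unitvN => /eqP /unitv_inj. Qed.

(** When c and d do not cancel, their sum has, at the position of c, a nonzero entry with the sign
    of c; one of a and b must then have this position and sign. *)
Lemma unitvD_inj a b c d : unitv a + unitv b != 0 ->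
  unitv a + unitv b = unitv c + unitv d -> c = a \/ c = b.
Proof.
move=> + e; rewrite e; case: a b c d e => [i s] [j t] [k r] [l q].
move=> /rowP /(_ k); rewrite !mxE /= eqxx => e nz.
have : ~~ ((k == l) && (q == ~~ r)).
  by apply: contra nz => /andP[/eqP <- /eqP ->]; rewrite (unitvN (k, r)) subrr.
by move: e {nz}; case: (eqVneq k i) => [ki|_]; case: (eqVneq k j) => [kj|_];
  case: (eqVneq k l) => [kl|_]; subst; case: s; case: t; case: r; case: q => //=;
  auto.
Qed.

(** The set E, with each nonzero element listed once: i = j gives the doubled unit vectors, i < j
    the sums with opposite signs and i > j those with equal signs. *)
Definition even_ball : seq 'rV[int]_n :=
  0 :: [seq unitv p.1 + unitv (p.2, p.1.2 (+) (p.1.1 < p.2)%N)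
         | p : ('I_n * bool) * 'I_n <- enum {: ('I_n * bool) * 'I_n}].

Lemma size_even_ball : size even_ball = (2 * n ^ 2 + 1)%N.
Proof.
by rewrite /= size_map -cardE !card_prod card_ord card_bool; lia.
Qed.

Lemma even_ball_uniq : uniq even_ball.
Proof.
have nz a (j : 'I_n) : unitv a + unitv (j, a.2 (+) (a.1 < j)%N) != 0.
  apply/eqP => /unitv_add0; case: a => i s [-> ] /=.
  by rewrite ltnn addbF; case: s.
rewrite /even_ball cons_uniq; apply/andP; split.
  by apply/mapP => -[[a j] _ /esym /eqP]; rewrite (negbTE (nz a j)).
rewrite map_inj_uniq ?enum_uniq // => -[a j] [[k r] l] /= e.
case: (unitvD_inj (nz a j) e) => [ca|cb].
  by move: e; rewrite ca => /addrI /unitv_inj [->].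
(* Here the two summands are exchanged. For i and j distinct, exactly one of i < j and j < i holds,
   and the signs disagree; so i = j. *)
move: e; rewrite cb addrC => /addrI /unitv_inj; case: a cb => i s /= [-> ->].
case=> <-; case: (ltngtP i j) => [||/val_inj ->]; case: s => //=.
Qed.

Lemma even_ball_wt x : x \in even_ball -> (wt x <= 2)%N /\ ~~ odd (wt x).
Proof.
rewrite inE => /orP[/eqP ->|/mapP[[a j] _ ->]]; first by rewrite wt0.
rewrite odd_wtD !wt_unitv; split=> //.
by rewrite (leq_trans (wtD _ _)) // !wt_unitv.
Qed.

End Vectors.

(** * Finite quotients and densities *)

(** The quotient of V by K is built on the positions in the transversal E: the class of x is the
    position of its representative, and classes are multiplied by adding representatives. *)
Lemma finite_zmod_quotient (V : zmodType) (K : {pred V}) (E : seq V) :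
  zmod_closed K -> uniq E -> (forall x, exists2 e, e \in E & x - e \in K) ->
  {in E &, forall e f, e - f \in K -> e = f} ->
  exists (H : finGroupType) (pi : V -> H),
    [/\ forall x y, pi (x + y) = (pi x * pi y)%g,
        forall x y, pi x = pi y <-> x - y \in K,
        forall h, exists2 e, e \in E & pi e = h & #|H| = size E].
Proof.
move=> Kz uE cov sep.
have K0 : 0 \in K by case: Kz.
have KB x y : x \in K -> y \in K -> x - y \in K by case: Kz => _; apply.
have KN x : x \in K -> - x \in K by move=> xK; rewrite -sub0r KB.
have KD x y : x \in K -> y \in K -> x + y \in K.
  by move=> xK yK; rewrite -[y]opprK KB // KN.
have KC x y : x - y \in K -> y - x \in K by move/KN; rewrite opprB.
have KT y x z : x - y \in K -> y - z \in K -> x - z \in K.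
  by move=> xy yz; rewrite -(subrKA y) KD.
pose idx x := find (fun e => x - e \in K) E.
have lt_find x : (idx x < size E)%N.
  by have [e eE xe] := cov x; rewrite -has_find; apply/hasP; exists e.
pose cl x : 'I_(size E) := Ordinal (lt_find x).
pose rep (i : 'I_(size E)) := nth 0 E i.
have repE i : rep i \in E by rewrite mem_nth.
have repK x : x - rep (cl x) \in K.
  have hasE : has (fun e => x - e \in K) E by rewrite has_find; apply: lt_find.
  exact: (nth_find 0 hasE).
have clP x y : cl x = cl y <-> x - y \in K.
  split=> [e|xy].
    by apply: KT (repK x) _; rewrite e; apply: KC.
  apply: val_inj; apply: eq_find => e /=.
  by apply/idP/idP; [apply: KT; apply: KC|apply: KT].
have clK i : cl (rep i) = i.
  apply: val_inj => /=.
  have : rep (cl (rep i)) = rep i by apply: sep => //; apply: KC; apply: repK.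
  by move/eqP; rewrite nth_uniq // => /eqP.
pose mul i j := cl (rep i + rep j).
have mulC : commutative mul by move=> i j; rewrite /mul addrC.
have mulr x j : mul (cl x) j = cl (x + rep j).
  by apply/clP; rewrite opprD addrACA subrr addr0; apply: KC.
have mulA : associative mul.
  move=> i j k; rewrite mulC.
  have -> : mul (mul j k) i = cl (rep j + rep k + rep i) by exact: mulr.
  have -> : mul (mul i j) k = cl (rep i + rep j + rep k) by exact: mulr.
  by congr cl; rewrite addrC addrA.
have mul1 : left_id (cl 0) mul by move=> i; rewrite mulr add0r clK.
have mulV : left_inverse (cl 0) (fun i => cl (- rep i)) mul.
  by move=> i; rewrite mulr addNr.
pose H : finGroupType :=
  HB.pack 'I_(size E) (Finite_isGroup.Build 'I_(size E) mulA mul1 mulV).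
exists H, cl; split=> [x y|x y|h|]; last exact: card_ord.
- rewrite [RHS](_ : _ = mul (cl x) (cl y)) // mulr.
  by apply/clP; rewrite opprD addrACA subrr add0r.
- exact: clP.
- by exists (rep h).
Qed.

(** * Exponential against polynomial growth *)

Lemma exp_gt_affine b : (b * (4 * b + 4) + 1 < 2 ^ (4 * b + 4))%N.
Proof.
(* The right side is the square of 2^(2b+2), which exceeds 2b + 2, and (2b+2)^2 already exceeds the
   left side. *)
have -> : (4 * b + 4 = (2 * b + 2) * 2)%N by lia.
rewrite expnM; have := ltn_expl (2 * b + 2) (ltnSn 1).
by move: (2 ^ (2 * b + 2))%N => c; rewrite expnS expn1; nia.
Qed.

(** This is Bernoulli's inequality (1 + 1/M)^k >= 1 + k/M at k = M, cleared of denominators. *)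
Lemma exp_succ_ge M : (0 < M)%N -> (2 * M ^ M <= M.+1 ^ M)%N.
Proof.
move=> M0; have bern k : (M ^ k * (M + k) <= M * M.+1 ^ k)%N.
  elim: k => [|k IHk]; first by rewrite !expn0; lia.
  by rewrite !expnS; move: IHk; move: (M ^ k)%N (M.+1 ^ k)%N => p q; nia.
have := bern M; rewrite -(leq_pmul2l M0).
by move: (M ^ M)%N (M.+1 ^ M)%N => p q; nia.
Qed.

Lemma exp_beats_poly M L n :
  exists k, (M ^ k * (2 * (k * L) + 1) ^ n < M.+1 ^ k)%N.
Proof.
case: (posnP M) => [->|M0]; first by exists 1%N; rewrite exp0n // mul0n.
(* For k = M(n+1)i the ratio of (M+1)^k to M^k is at least 2^((n+1)i), while 2kL + 1 = bi + 1 is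
   below 2^i by the choice of i. The exponent n + 1 keeps the inequality of powers strict when n =
   0. *)
pose b := (2 * M * n.+1 * L)%N; pose i := (4 * b + 4)%N.
exists (M * (n.+1 * i))%N; rewrite !expnM -!expnM.
have le1 : (2 ^ (n.+1 * i) * (M ^ (M * (n.+1 * i)))
              <= M.+1 ^ (M * (n.+1 * i)))%N.
  rewrite [(M.+1 ^ _)%N]expnM [(M ^ _)%N]expnM -expnMn.
  by rewrite leq_exp2r ?exp_succ_ge // muln_gt0 /= /i addnS.
apply: leq_trans le1; rewrite mulnC ltn_pmul2r ?expn_gt0 ?M0 //.
apply: (@leq_ltn_trans ((b * i + 1) ^ n.+1)%N).
  have -> : (2 * (M * (n.+1 * i) * L) = b * i)%N by rewrite /b; lia.
  by rewrite leq_pexp2l // addn1.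
by rewrite [(n.+1 * i)%N]mulnC expnM ltn_exp2r // exp_gt_affine.
Qed.

(** A duplicate-free list in A of maximal length exhausts A, since a missing element could be
    prepended. *)
Lemma finite_of_bound (T : eqType) (A : set T) M :
  (forall s, uniq s -> {in s, forall x, A x} -> (size s <= M)%N) ->
  exists s, [/\ uniq s, forall x, x \in s <-> A x & (size s <= M)%N].
Proof.
move=> bd.
pose P k := `[< exists s, [/\ uniq s, {in s, forall x, A x} & size s = k] >].
have exP : exists k, P k by exists 0%N; apply/asboolP; exists [::].
have bdP k : P k -> (k <= M)%N by case/asboolP=> s [us sA <-]; apply: bd.
case: (ex_maxnP exP bdP) => k /asboolP[s [us sA sk]] kmax.
exists s; split=> [//|x|]; last exact: bd.
split=> [/sA//|Ax]; apply/negPn/negP => xs.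
suff /kmax : P k.+1 by rewrite ltnn.
apply/asboolP; exists (x :: s); split=> /=; [by rewrite xs| |by rewrite sk].
by move=> y; rewrite inE => /orP[/eqP ->|/sA].
Qed.

(** * Counting the points of a subgroup in growing boxes *)

Section Density.
Variable n : nat.
Implicit Types (v x c : 'rV[int]_n).

Definition box N : seq 'rV[int]_n :=
  [seq \row_i ((f i : nat)%:Z - N%:Z) | f : {ffun 'I_n -> 'I_(2 * N + 1)}].

Lemma size_box N : size (box N) = ((2 * N + 1) ^ n)%N.
Proof. by rewrite size_map -cardE card_ffun !card_ord. Qed.

Lemma box_uniq N : uniq (box N).
Proof.
rewrite map_inj_uniq ?enum_uniq // => f g /rowP fg; apply/ffunP => i.
by apply: val_inj => /=; have := fg i; rewrite !mxE; lia.
Qed.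

Lemma mem_box N v : v \in box N <-> forall i, (`|v ord0 i| <= N)%N.
Proof.
split=> [/mapP[f _ ->] i|vN].
  by rewrite mxE; case: (f i) => k /=; lia.
have lt_i i : (absz (v ord0 i + N%:Z)%R < 2 * N + 1)%N by have := vN i; lia.
apply/mapP; exists [ffun i => Ordinal (lt_i i)]; first by rewrite mem_enum.
by apply/rowP => i; rewrite mxE ffunE /= -(ord1 ord0); have := vN i; lia.
Qed.

Lemma entry_le_wt v i : (`|v ord0 i| <= wt v)%N.
Proof. by rewrite /wt (bigD1 i) //= leq_addr. Qed.

(* If K cosets of C were separated with K > M, then box N + L would contain
   K / M times more points of C than box N for every N, against the polynomial
   growth of the boxes. *)
Lemma coset_count (C : {pred 'rV[int]_n}) (tile : 'rV[int]_n -> seq 'rV[int]_n)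
    (r M : nat) (xs : seq 'rV[int]_n) :
  zmod_closed C -> (forall v, exists2 c, c \in C & v \in tile c) ->
  {in C, forall c, size (tile c) <= M}%N ->
  (forall c v, v \in tile c -> wt (v - c) <= r)%N ->
  uniq xs -> {in xs &, forall x y, x - y \in C -> x = y} -> (size xs <= M)%N.
Proof.
move=> [C0 CB] cov tM tr uxs sep; rewrite leqNgt; apply/negP => Mxs.
pose cb N := [seq v <- box N | v \in C].
pose L := (\sum_(x <- xs) wt x + r)%N.
(* The sums x + c, for x in [xs] and c in C within the box of radius N, are distinct. Each lies in
   the tile of a point of C that differs from c by at most L in every coordinate. *)
have step N : (M.+1 * size (cb N) <= M * size (cb (N + L)))%N.
  apply: (@leq_trans (size [seq x + c | x <- xs, c <- cb N])).
    by rewrite size_allpairs leq_mul2r Mxs orbT.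
  apply: (@leq_trans (size (flatten [seq tile c | c <- cb (N + L)%N]))).
    apply: uniq_leq_size.
      rewrite allpairs_uniq ?filter_uniq ?box_uniq //.
      move=> _ _ /allpairsP[[x c] [/= xx cc ->]]
        /allpairsP[[y d] [/= yx dc ->]] /= e.
      have xy : x = y.
        apply: sep => //; suff -> : x - y = d - c.
          move: cc dc; rewrite !mem_filter => /andP[cC _] /andP[dC _].
          exact: CB.
        by apply/eqP; rewrite subr_eq addrAC -subr_eq opprK e addrC.
      by move: e; rewrite xy => /addrI ->.
    move=> _ /allpairsP[[x c] [/= xx + ->]].
    rewrite mem_filter => /andP[cC /mem_box cN].
    have [c' c'C vc'] := cov (x + c).
    apply/flattenP; exists (tile c') => //; apply: map_f.
    rewrite mem_filter c'C; apply/mem_box => i.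
    have := cN i; have := entry_le_wt x i; have := entry_le_wt (x + c - c') i.
    have := tr _ _ vc'.
    have : (wt x <= \sum_(y <- xs) wt y)%N by rewrite (big_rem x) //= leq_addr.
    rewrite !mxE /L; move: (wt x) (wt (x + c - c')) (\sum_(y <- xs) wt y)%N.
    move: (x ord0 i) (c ord0 i) (c' ord0 i) => p q s; lia.
  rewrite size_flatten /shape -map_comp sumnE big_map.
  apply: (@leq_trans (\sum_(c <- cb (N + L)%N) M)).
    rewrite big_seq [leqRHS]big_seq; apply: leq_sum => c.
    by rewrite mem_filter => /andP[/tM].
  by rewrite big_const_seq count_predT iter_addn_0.
have iter k : (M.+1 ^ k <= M ^ k * size (cb (k * L)))%N.
  elim: k => [|k IHk].
    rewrite !expn0 mul1n lt0n size_eq0 -has_filter.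
    by apply/hasP; exists 0 => //; apply/mem_box => i; rewrite mxE.
  rewrite !expnS [(k.+1 * L)%N]mulSnr.
  apply: leq_trans (leq_mul (leqnn M.+1) IHk) _.
  by rewrite mulnCA [(M * M ^ k)%N]mulnC -mulnA leq_mul2l step orbT.
have [k] := exp_beats_poly M L n; rewrite ltnNge => /negP; apply.
apply: leq_trans (iter k) _; rewrite leq_mul2l -size_box size_filter.
by rewrite count_size orbT.
Qed.

End Density.

(** * Coefficients in the group ring *)

Section GroupRingCoefficients.
Variable H : finGroupType.
Implicit Types (T : {set H}) (g : H).

Lemma gr_sumE (I : finType) (P : pred I) (F : I -> group_ring H) g :
  (\sum_(i | P i) F i) g = \sum_(i | P i) F i g.
Proof.
by apply: (big_morph (fun a : group_ring H => a g)) => [a b|]; rewrite ffunE.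
Qed.

Lemma gr_setE T g : gr_set T g = (g \in T)%:R :> int.
Proof.
rewrite gr_sumE; under eq_bigr do rewrite ffunE.
case: (boolP (g \in T)) => [gT|gT].
  rewrite (bigD1 g) //= eqxx big1 ?addr0 // => h /andP[_ /negbTE hg].
  by rewrite eq_sym hg.
by rewrite big1 // => h hT; case: eqP gT => // ->; rewrite hT.
Qed.

Lemma gr_pow_setE T (t : int) g :
  gr_pow (gr_set T) t g = #|[set s in T | expgz s t == g]|%:R :> int.
Proof.
rewrite gr_sumE (eq_bigr (fun s => ((s \in T) && (expgz s t == g))%:R)).
  by rewrite -natr_sum -big_mkcond sum1dep_card.
move=> s _; rewrite gr_setE; case: (s \in T) => /=; last first.
  by rewrite mulr0z ffunE.
by rewrite mulr1z ffunE eq_sym.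
Qed.

Lemma gr_set_sqrE T g :
  (gr_set T ^+ 2) g = #|[set s in T | (s^-1 * g)%g \in T]|%:R :> int.
Proof.
rewrite expr2 ffunE (eq_bigr (fun s => ((s \in T) && ((s^-1 * g)%g \in T))%:R)).
  by rewrite -natr_sum -big_mkcond sum1dep_card.
by move=> s _; rewrite !gr_setE -natrM mulnb.
Qed.

Lemma gr_set_symP T : gr_set T = gr_pow (gr_set T) (-1) <->
  forall g, (g^-1%g \in T) = (g \in T).
Proof.
have E g : gr_pow (gr_set T) (-1) g = (g^-1%g \in T)%:R :> int.
  rewrite gr_pow_setE; congr (_%:R).
  have -> : [set s in T | expgz s (-1) == g] = [set s in T | s == g^-1%g].
    by apply/setP => s; rewrite !inE /= (can2_eq (@invgK H) (@invgK H)).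
  case: (boolP (g^-1%g \in T)) => gT.
    rewrite (_ : [set _ | _] = [set g^-1%g]) ?cards1 //; apply/setP => s.
    by rewrite !inE andbC; case: eqP => // ->.
  apply: eq_card0 => s; rewrite !inE; apply/negP => /andP[sT /eqP e].
  by rewrite -e sT in gT.
split=> [e g|sT]; last by apply/ffunP => g; rewrite E gr_setE sT.
have /(congr1 (fun f : group_ring H => f g)) := e; rewrite E gr_setE.
by case: (g \in T); case: (_ \in T).
Qed.

(** At g, the first number counts ordered pairs in T with product g, the second square roots of g in
    T; their sum is twice the number of unordered pairs when T is commutative. *)
Lemma gr_set_sqrP T k :
  gr_set T ^+ 2 = gr_set [set: H] *+ 2 - gr_pow (gr_set T) 2 + gr_elt 1%g *+ k
  <-> forall g, (#|[set s in T | (s^-1 * g)%g \in T]|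
                  + #|[set s in T | (s ^+ 2)%g == g]| = 2 + k * (g == 1%g))%N.
Proof.
have mulrnE (a : group_ring H) m g : (a *+ m) g = a g *+ m.
  by elim: m => [|m IHm]; rewrite ?mulr0n ?ffunE // !mulrS ffunE IHm.
have E g : (gr_set [set: H] *+ 2 - gr_pow (gr_set T) 2 + gr_elt 1%g *+ k) g
   = 2 - #|[set s in T | (s ^+ 2)%g == g]|%:R + (k * (g == 1%g))%:R :> int.
  rewrite !ffunE !mulrnE gr_setE gr_pow_setE ffunE inE.
  by congr (_ + _); rewrite natrM mulr_natl.
split=> [e g|e]; last first.
  by apply/ffunP => g; rewrite E gr_set_sqrE; have := e g; lia.
have /(congr1 (fun f : group_ring H => f g)) := e; rewrite E gr_set_sqrE; lia.
Qed.

Lemma expgzS (g : H) (t : int) : expgz g (t + 1) = (expgz g t * g)%g.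
Proof.
case: t => [m|[|m]]; first by rewrite -PoszD addn1 /= expgSr.
  by rewrite /= expg1 mulVg.
have -> : Negz m.+1 + 1 = Negz m by lia.
by rewrite /= [in RHS]expgS invMg mulgKV.
Qed.

Lemma expgzD (g : H) (t u : int) :
  expgz g (t + u) = (expgz g t * expgz g u)%g.
Proof.
elim/int_ind: u => [|m IHm|m IHm]; first by rewrite addr0 /= expg0 mulg1.
  by rewrite -addn1 PoszD addrA !expgzS IHm mulgA.
apply: (mulIg g); rewrite -mulgA -!expgzS -addrA.
have -> : - m.+1%:Z + 1 = - m%:Z by lia.
exact: IHm.
Qed.

End GroupRingCoefficients.

Local Open Scope classical_set_scope.
Local Open Scope card_scope.

(** * From groups to codes *)

(** From each pair of distinct inverse elements of T, [h] keeps the one that comes first in the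
    enumeration of H. The boolean of [t] follows the sign convention of [unitv]. *)
Lemma half_system (H : finGroupType) (T : {set H}) n :
  #|T| = (2 * n)%N -> (forall g, (g^-1%g \in T) = (g \in T)) ->
  {in T, forall g, g^-1%g != g} ->
  exists h : 'I_n -> H,
    let t (a : 'I_n * bool) := if a.2 then (h a.1)^-1%g else h a.1 in
    injective t /\ forall g, (g \in T) = [exists a, t a == g].
Proof.
move=> cT sT nT.
pose P := [set g in T | (enum_rank g < enum_rank g^-1%g)%N].
have PV g : g \in T -> (g^-1%g \in P) = (g \notin P).
  move=> gT; rewrite !inE sT gT invgK /= -leqNgt ltn_neqAle.
  by rewrite (inj_eq val_inj) (inj_eq enum_rank_inj) nT.
have cP : #|P| = n.
  have := cardsID P T.
  have -> : T :&: P = P.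
    by apply/finset.setIidPr/fintype.subsetP => g; rewrite inE => /andP[].
  have -> : T :\: P = (fun g => g^-1)%g @: P.
    apply/setP => g; rewrite inE; apply/andP/imsetP => [[gP gT]|[k kP ->]].
      by exists g^-1%g; rewrite ?invgK ?PV.
    have kT : k \in T by move: kP; rewrite inE => /andP[].
    by rewrite sT PV // negbK kT.
  rewrite card_imset ?cT; last exact: invg_inj.
  by move: #|P|; lia.
exists (fun i => enum_val (cast_ord (esym cP) i)) => t.
have hP i : enum_val (cast_ord (esym cP) i) \in P by exact: enum_valP.
have PT k : k \in P -> k \in T by rewrite inE => /andP[].
rewrite /t; split=> [[i b] [j c] /= e|g].
  have bc : b = c.
    case: b c e => [] [] //= e; have := PV _ (PT _ (hP i)).
      by rewrite e !hP.
    by have := PV _ (PT _ (hP j)); rewrite -e !hP.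
  move: e; rewrite bc.
  by case: c {bc} => [/invg_inj|] /enum_val_inj /cast_ord_inj ->.
apply/idP/existsP => [gT|[[i b] /eqP <-]]; last by case: b; rewrite ?sT PT.
have getI k : k \in P -> exists i, enum_val (cast_ord (esym cP) i) = k.
  move=> kP; exists (cast_ord cP (enum_rank_in kP k)).
  by rewrite cast_ordK enum_rankK_in.
have [/getI[i <-]|gP] := boolP (g \in P); first by exists (i, false).
have /getI[i e] : g^-1%g \in P by rewrite PV.
by exists (i, true); rewrite /= e invgK.
Qed.

(** The hypotheses on [tau] say that only opposite unit vectors have product 1 and that any other
    element is a product of two in one way up to order. The index [i0] provides the direction in
    which two copies of E are joined into a tile. *)
Lemma code_of_hom (n : nat) (i0 : 'I_n) (H : finGroupType)
    (phi : 'rV[int]_n -> H) :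
  let tau a := phi (unitv a) in
  (forall x y, phi (x + y) = phi x * phi y)%g ->
  (forall a b, tau a * tau b = 1 -> b = negu a)%g ->
  (forall a b c d, tau a * tau b = tau c * tau d -> tau a * tau b <> 1 ->
     c = a \/ c = b)%g ->
  (forall g, g <> 1 -> exists a b, g = tau a * tau b)%g ->
  exists C : set 'rV[int]_n, linear_code C /\ DPL_code 6 C.
Proof.
move=> tau phiD tau1 tau_inj tau_surj.
have phi0 : phi 0 = 1%g by apply: (mulgI (phi 0)); rewrite -phiD addr0 mulg1.
have phiN x : phi (- x) = (phi x)^-1%g.
  by apply: (mulgI (phi x)); rewrite -phiD subrr mulgV phi0.
pose C : set 'rV[int]_n := fun x => phi x = 1%g /\ ~~ odd (wt x).
have CB x y : C x -> C y -> C (x - y).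
  move=> [px ox] [py oy]; split; first by rewrite phiD phiN px py invg1 mulg1.
  by rewrite odd_wtB (negbTE ox) (negbTE oy).
have Cmin x : C x -> (wt x <= 5)%N -> x = 0.
  move=> [px ox] w5.
  case wx : (wt x) => [|[|[|[|[|[|k]]]]]] in ox w5 *; rewrite // in ox w5.
  - exact: wt_eq0.
  - have [a [b xE]] : exists a b, x = unitv a + unitv b.
      apply: wt_le2_even; rewrite ?wx //.
      by apply/eqP => x0; rewrite x0 wt0 in wx.
    have /tau1 ba : (tau a * tau b = 1)%g by rewrite -phiD -xE.
    by rewrite xE ba unitvN subrr.
  (* Weight 4: write x = a + b + c + d. Since a + b and -c - d have the same image, two of the four
     vectors cancel, and x would have weight at most 2. *)
  have [a wa] := wt_pred wx; have [b wb] := wt_pred wa.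
  have [c [d yE]] : exists c d, x - unitv a - unitv b = unitv c + unitv d.
    apply: wt_le2_even; rewrite ?wb //.
    by apply/eqP => y0; rewrite y0 wt0 in wb.
  have xE : x = unitv a + unitv b + (unitv c + unitv d).
    by rewrite -yE -[x - _ - _]addrA -opprD [RHS]addrC subrK.
  have short e f : x = unitv e + unitv f -> x = 0.
    by move=> xef; have := wtD (unitv e) (unitv f); rewrite -xef wx !wt_unitv.
  have pE : (tau a * tau b = tau (negu c) * tau (negu d))%g.
    rewrite /tau -!phiD !unitvN -opprD phiN.
    by apply: (mulIg (phi (unitv c + unitv d))); rewrite mulVg -phiD -xE.
  have [/tau1 ba|/eqP p1] := eqVneq (tau a * tau b)%g 1%g.
    by apply: (short c d); rewrite xE ba unitvN subrr add0r.
  have [ca|cb] := tau_inj _ _ _ _ pE p1.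
    apply: (short b d); rewrite xE -ca unitvN.
    by rewrite addrACA addNr add0r.
  apply: (short a d); rewrite xE -cb unitvN.
  by rewrite -addrA addKr.
pose E (w : 'rV[int]_n) := (wt w <= 2)%N && ~~ odd (wt w).
pose e := unitv (i0, false).
pose W : set 'rV[int]_n := fun w => E w || E (w - e).
have cov v : exists2 c, C c & W (v - c).
  have covE x : ~~ odd (wt x) -> exists2 w, E w & C (x - w).
    move=> ox; have [p1|/eqP/tau_surj[a [b pab]]] := eqVneq (phi x) 1%g.
      by exists 0; rewrite /E ?wt0 // subr0.
    have oab : ~~ odd (wt (unitv a + unitv b)) by rewrite odd_wtD !wt_unitv.
    exists (unitv a + unitv b).
      by rewrite /E oab andbT (leq_trans (wtD _ _)) // !wt_unitv.
    split; last by rewrite odd_wtB (negbTE ox) (negbTE oab).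
    by rewrite phiD phiN pab phiD mulgV.
  (* Even vectors are covered by translates of E, odd ones by translates of E + e. *)
  have [ov|ov] := boolP (odd (wt v)); last first.
    by have [w Ew Cw] := covE v ov; exists (v - w); rewrite // subKr /W Ew.
  have [|w Ew Cw] := covE (v - e); first by rewrite odd_wtB ov wt_unitv.
  exists (v - e - w) => //; rewrite /W.
  have -> : v - (v - e - w) - e = w.
    by rewrite -[v - e - w]addrA -opprD subKr addrC addKr.
  by rewrite Ew orbT.
have Wdiam w w' : W w -> W w' -> (wt (w - w') <= 5)%N.
  have we z : (wt z <= wt (z - e) + 1)%N.
    by have := wtD (z - e) e; rewrite subrK wt_unitv.
  move=> /orP[] /andP[w2 _] /orP[] /andP[w2' _].
  - by have := wtB w w'; lia.
  - by have := wtB w w'; have := we w'; lia.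
  - by have := wtB w w'; have := we w; lia.
  have -> : w - w' = (w - e) - (w' - e) by rewrite opprB addrA subrK.
  by apply: leq_trans (wtB _ _) _; apply: leq_trans (leq_add w2 w2') _.
exists C; split.
  split; first by rewrite inE; split; rewrite ?wt0.
  by move=> x y; rewrite !inE; apply: CB.
split=> [u v Cu Cv uv|].
  rewrite lee_distE leqNgt; apply/negP => /(Cmin _ (CB _ _ Cu Cv)) /eqP.
  by rewrite subr_eq0 => /eqP.
have Wsep c c' v : C c -> C c' -> W (v - c) -> W (v - c') -> c = c'.
  move=> Cc Cc' Wc Wc'; apply/eqP; rewrite -subr_eq0; apply/eqP.
  apply: Cmin; first exact: CB.
  by have := Wdiam _ _ Wc' Wc; rewrite opprB addrC addrA subrK.
have CW c : C c -> C `&` [set v | W (v - c)] = [set c].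
  move=> Cc; apply/seteqP; split=> v /=; last first.
    by move=> ->; split=> //; rewrite /W subrr /E wt0.
  move=> [Cv Wv]; apply: (Wsep _ _ v) => //.
  by rewrite /W subrr /E wt0.
exists {c | C c}, (fun c => [set v | W (v - sval c)]); split.
- split; last by move=> c _; exists (sval c); rewrite /= subrr /W /E wt0.
    apply/seteqP; split=> // v _; have [c Cc Wc] := cov v.
    by exists (exist _ c Cc).
  move=> [c Cc] [c' Cc'] _ _ /= [v [/= Wc Wc']].
  by apply: eq_exist; apply: (Wsep _ _ v).
- move=> [c Cc] /=; split=> [u v Wu Wv|A dA].
    by rewrite lee_distE; have := Wdiam _ _ Wu Wv; rewrite opprB addrA subrK.
  (* Maximality of the tile at c: every vector reduces modulo C into this tile, and the reduction is
     injective on an anticode of diameter 5 because a codeword of weight at most 5 is 0. *)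
  have {}cov v : exists w, W (w - c) /\ C (v - w).
    have [c' Cc' Wc'] := cov (v); exists (v - c' + c).
    by rewrite addrK; split=> //; rewrite opprD addrA subKr; apply: CB.
  have /choice [r rP] := cov.
  have rinj : {in A &, injective r}.
    move=> u v; rewrite !inE => Au Av ruv; apply/eqP; rewrite -subr_eq0.
    apply/eqP; apply: Cmin; last by rewrite -lee_distE dA.
    have -> : u - v = (u - r u) - (v - r v) by rewrite ruv opprB addrA subrK.
    by apply: CB; [case: (rP u)|case: (rP v)].
  rewrite -(card_le_eql (inj_card_eq rinj)); apply: subset_card_le => _ [v _ <-].
  by case: (rP v).
- by move=> [c Cc] /=; rewrite CW //; apply: card_set1.
- move=> [c Cc] [c' Cc'] /= cc'; rewrite !CW // => /seteqP[/(_ c erefl) /= e' _].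
  by apply: cc'; apply: eq_exist.
Qed.

Lemma code_of_group n (H : finGroupType) (T : {set H}) : (0 < n)%N ->
  abelian [set: H]%SET -> #|T| = (2 * n)%N -> gr_set T = gr_pow (gr_set T) (-1) ->
  gr_set T ^+ 2 = gr_set [set: H]%SET *+ 2 - gr_pow (gr_set T) 2
                  + gr_elt 1%g *+ (2 * n - 2) ->
  exists C : set 'rV[int]_n, linear_code C /\ DPL_code 6 C.
Proof.
move=> n0 abH cT /gr_set_symP sT /gr_set_sqrP sqT.
have mulC (x y : H) : (x * y = y * x)%g by apply: (centsP abH); rewrite inE.
(* At 1 the ordered pairs alone number 2n = 2 + (2n - 2), so no square root of 1 is left in T. *)
have T2 : {in T, forall g, g^-1%g != g}.
  move=> g gT; apply/eqP => gV; have := sqT 1%g; rewrite eqxx.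
  have -> : [set s in T | (s^-1 * 1)%g \in T]%SET = T.
    by apply/setP => s; rewrite inE mulg1 sT andbb.
  rewrite cT muln1; set S := [set s in T | _]%SET.
  suff : (0 < #|S|)%N by move: #|S|; lia.
  by apply/card_gt0P; exists g; rewrite inE gT expgS expg1 -{1}gV mulVg eqxx.
(* Away from 1 the two counts add up to 2. They are used up by s and t as two first factors, or, if
   s = t, by one first factor and one square root; another first factor s' would make 3. *)
have pairT s t s' t' : s \in T -> t \in T -> s' \in T -> t' \in T ->
    (s * t = s' * t' -> s * t <> 1 -> s' = s \/ s' = t)%g.
  move=> sin tin s'in t'in e /eqP/negbTE ne1; have := sqT (s * t)%g.
  rewrite ne1 muln0 addn0; set N := [set u in T | _]%SET.
  set S := [set u in T | _]%SET.
  have sN : s \in N by rewrite inE sin mulKg.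
  have tN : t \in N by rewrite inE tin mulC mulgK.
  have s'N : s' \in N by rewrite inE s'in e mulKg.
  have [s's|/eqP s's] := eqVneq s' s; first by left.
  have [s't|/eqP s't] := eqVneq s' t; first by right.
  have [st|st] := eqVneq s t.
    have : s \in S by rewrite inE sin st expgS expg1 eqxx.
    rewrite (cardsD1 s S) => ->; rewrite (cardsD1 s N) sN (cardsD1 s' (N :\ s)).
    by rewrite !inE in s'N *; rewrite s'N; move/eqP: s's => ->; lia.
  rewrite (cardsD1 s N) sN (cardsD1 t (N :\ s)) (cardsD1 s' (N :\ s :\ t)).
  have -> : t \in N :\ s by rewrite in_setD1 tN eq_sym st.
  have -> : s' \in N :\ s :\ t.
    by rewrite !in_setD1 s'N andbT; apply/andP; split; apply/eqP.
  lia.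
have covT g : g <> 1%g -> exists s t, [/\ s \in T, t \in T & g = (s * t)%g].
  move=> /eqP/negbTE g1; have := sqT g; rewrite g1 muln0 addn0.
  set N := [set s in T | _]%SET; set S := [set s in T | _]%SET => NS.
  have [N0|[s]] := set_0Vmem N; last first.
    by rewrite inE => /andP[sin tin]; exists s, (s^-1 * g)%g; rewrite mulKVg.
  have [S0|[s]] := set_0Vmem S; first by rewrite N0 S0 !cards0 in NS.
  by rewrite inE expgS expg1 => /andP[sin /eqP <-]; exists s, s.
have [h [tau_inj tauT]] := half_system cT sT T2.
pose phi (x : 'rV[int]_n) : H := (\prod_(i < n) expgz (h i) (x ord0 i))%g.
have phiD x y : phi (x + y) = (phi x * phi y)%g.
  rewrite /phi; elim/big_rec3: _ => [|i z u w _ ->]; first by rewrite mulg1.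
  by rewrite mxE expgzD -!mulgA; congr mulg; rewrite !mulgA [(_ * u)%g]mulC.
have phiE a : phi (unitv a) = (if a.2 then (h a.1)^-1 else h a.1)%g.
  rewrite /phi (big_only1 a.1) // => [|j /negbTE ja _]; rewrite !mxE.
    by rewrite eqxx; case: a.2; rewrite /= expg1.
  by rewrite ja.
have tT a : phi (unitv a) \in T.
  by rewrite tauT; apply/existsP; exists a; rewrite phiE.
have phi_inj a b : phi (unitv a) = phi (unitv b) -> a = b.
  by rewrite !phiE => /tau_inj.
have getT g : g \in T -> exists a, g = phi (unitv a).
  by rewrite tauT => /existsP[a /eqP <-]; exists a; rewrite phiE.
have phiN a : phi (unitv (negu a)) = (phi (unitv a))^-1%g.
  by rewrite !phiE /=; case: a.2; rewrite /= ?invgK.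
apply: (@code_of_hom n (Ordinal n0) H phi) => //.
- move=> a b ab; apply: phi_inj; rewrite phiN; apply/eqP.
  by rewrite eq_sym eq_invg_mul ab.
- move=> a b c d e ne1.
  by case: (pairT _ _ _ _ (tT a) (tT b) (tT c) (tT d) e ne1) => /phi_inj; auto.
- move=> g /covT[s [t [/getT[a ->] /getT[b ->] ->]]]; by exists a, b.
Qed.

(** * From codes to groups *)

Lemma linear_code0 n (C : set 'rV[int]_n) : linear_code C -> C 0.
Proof. by case; rewrite inE. Qed.

Lemma linear_codeB n (C : set 'rV[int]_n) x y :
  linear_code C -> C x -> C y -> C (x - y).
Proof. by case=> _ CB Cx Cy; have := CB x y; rewrite !inE; apply. Qed.

Lemma linear_codeD n (C : set 'rV[int]_n) x y :
  linear_code C -> C x -> C y -> C (x + y).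
Proof.
move=> linC Cx Cy; rewrite -[y]opprK -[- y]sub0r.
by do 2?apply: (linear_codeB linC) => //; apply: linear_code0.
Qed.

Lemma DPL6_min_wt n (C : set 'rV[int]_n) x :
  linear_code C -> DPL_code 6 C -> C x -> (wt x <= 5)%N -> x = 0.
Proof.
move=> /linear_code0 C0 [+ _] Cx wx => /(_ x 0 Cx C0).
rewrite lee_distE subr0 => dx; apply/eqP/negPn/negP => /eqP /dx.
by rewrite leqNgt ltnS wx.
Qed.

(** The parts of the partition are anticodes of diameter 5, so each is finite, has at most 4n^2 + 2
    points and stays within distance 5 of its codeword; the density count applies to them. *)
Lemma DPL6_index n (C : set 'rV[int]_n) (xs : seq 'rV[int]_n) :
  linear_code C -> DPL_code 6 C -> uniq xs ->
  {in xs &, forall x y, C (x - y) -> x = y} -> (size xs <= 4 * n ^ 2 + 2)%N.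
Proof.
move=> linC [_ [I [W [[Wcov Wtriv _] Wmax WC _]]]] uxs sep.
have Wwt i u v : W i u -> W i v -> (wt (u - v) <= 5)%N.
  by rewrite -lee_distE; case: (Wmax i) => + _; apply.
(* The tile of a codeword lists the part containing it; the empty list is the default for other
   vectors. *)
have tileP c : exists s : seq 'rV[int]_n, [/\ (size s <= 4 * n ^ 2 + 2)%N,
    forall v, v \in s -> (wt (v - c) <= 5)%N &
    C c -> exists2 i, W i c & forall v, W i v -> v \in s].
  have [Cc|nC] := pselect (C c); last by exists [::].
  have : [set: 'rV[int]_n] c by [].
  rewrite -Wcov => -[i _ Wic].
  have bd s : uniq s -> {in s, forall x, W i x} -> (size s <= 4 * n ^ 2 + 2)%N.
    move=> us sW; apply: anticode5_size => // u v /sW Wu /sW Wv.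
    by rewrite lee_distE (Wwt i).
  have [s [us sW sM]] := finite_of_bound bd.
  exists s; split=> // [v /sW Wv|_]; first exact: (Wwt i).
  by exists i => // v /sW.
have /choice[tile tileE] := tileP.
apply: (@coset_count n [in C] tile 5 (4 * n ^ 2 + 2) xs linC) => //.
- move=> v; have : [set: 'rV[int]_n] v by [].
  rewrite -Wcov => -[i _ Wiv].
  have : C `&` W i !=set0.
    apply/set0P/negP => /eqP C0; have := WC i.
    by rewrite C0 card_eq_sym card_eq0 => /eqP /seteqP[/(_ 0%N isT)].
  move=> [c [Cc Wic]]; exists c; first by rewrite !inE.
  have [_ _ /(_ Cc) [j Wjc]] := tileE c; apply.
  by rewrite (Wtriv j i) //; exists c.
- by move=> c _; case: (tileE c).
- by move=> c v vt; case: (tileE c) => _ + _; apply.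
- by move=> x y xx yx; rewrite !inE => Cxy; apply: sep.
Qed.

Lemma transversal_of_DPL6 n (C : set 'rV[int]_n) :
  (0 < n)%N -> linear_code C -> DPL_code 6 C ->
  forall v, ~~ odd (wt v) -> exists2 e, e \in even_ball n & C (v - e).
Proof.
move=> n0 linC dplC.
have C0 := linear_code0 linC; have CB x y := @linear_codeB _ _ x y linC.
have Cmin x := @DPL6_min_wt _ _ x linC dplC.
pose P v := exists2 e, e \in even_ball n & C (v - e).
(* The 4n^2 + 2 points of E and E + a are pairwise incongruent modulo C, so v is not congruent to
   points of both halves. If it were congruent to neither, adding v would exceed the bound on the
   index. *)
have PN a v : P v <-> ~ P (v - unitv a).
  pose Wl := even_ball n ++ [seq e + unitv a | e <- even_ball n].
  have Wwt x : x \in Wl ->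
      exists2 e, e \in even_ball n & x = e \/ x = e + unitv a.
    by rewrite mem_cat => /orP[xe|/mapP[e ee ->]]; [exists x|exists e]; auto.
  have sep : {in Wl &, forall x y, C (x - y) -> x = y}.
    move=> x y /Wwt[e /even_ball_wt[we _] xE] /Wwt[f /even_ball_wt[wf _] yE] Cxy.
    apply/eqP; rewrite -subr_eq0; apply/eqP/Cmin => //.
    have b0 : (wt (e - f) <= 4)%N := leq_trans (wtB e f) (leq_add we wf).
    have b1 : (wt (e - f + unitv a) <= 5)%N.
      by apply: leq_trans (wtD _ _) _; rewrite wt_unitv addn1.
    have b2 : (wt (e - f - unitv a) <= 5)%N.
      by apply: leq_trans (wtB _ _) _; rewrite wt_unitv addn1.
    case: xE => ->; case: yE => ->; first exact: leq_trans b0 _.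
    - by rewrite opprD addrA.
    - by rewrite addrAC.
    - by rewrite opprD addrACA subrr addr0; apply: leq_trans b0 _.
  have parity e f : e \in even_ball n -> f \in even_ball n -> e <> f + unitv a.
    move=> /even_ball_wt[_ oe] /even_ball_wt[_ of'] ef; move: oe.
    by rewrite ef odd_wtD wt_unitv (negbTE of').
  have uWl : uniq Wl.
    rewrite cat_uniq even_ball_uniq map_inj_uniq; last exact: addIr.
    rewrite even_ball_uniq andbT.
    apply/hasPn => _ /mapP[f fe ->]; apply/negP => /parity /(_ fe).
    exact.
  have sWl : size Wl = (4 * n ^ 2 + 2)%N.
    by rewrite size_cat size_map size_even_ball; lia.
  split=> [[e ee Ce] [f fe Cf]|nP].
    apply: (parity e f) => //; apply: sep.
    - by rewrite mem_cat ee.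
    - by rewrite mem_cat (map_f (+%R^~ (unitv a))) ?orbT.
    have -> : e - (f + unitv a) = (v - unitv a - f) - (v - e).
      by rewrite opprB [RHS]addrC addrA [f + _]addrC opprD !addrA subrK.
    exact: CB.
  apply: contrapT => nPv.
  have nW w : w \in Wl -> ~ C (v - w).
    rewrite mem_cat => /orP[we Cvw|/mapP[f fe ->] Cvw].
      by apply: nPv; exists w.
    by apply: nP; exists f => //; rewrite addrAC; move: Cvw; rewrite opprD addrA.
  suff : (size (v :: Wl) <= 4 * n ^ 2 + 2)%N.
    by rewrite -[size _]/(size Wl).+1 sWl ltnn.
  apply: (DPL6_index linC dplC) => [|x y].
    rewrite cons_uniq uWl andbT; apply/negP => /nW; rewrite subrr; apply.
    exact: C0.
  rewrite !inE => /orP[/eqP ->|xW] /orP[/eqP ->|yW] // Cxy.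
  - by case: (nW _ yW Cxy).
  - by case: (nW _ xW); rewrite -opprB -sub0r; apply: CB.
  - exact: sep.
(* [P] holds at 0 and flips at each unit step, so by induction on the weight it coincides with
   evenness. *)
move=> v ov; suff : P v <-> ~~ odd (wt v) by case=> _; apply.
have [k] := ubnP (wt v); elim: k v {ov} => // k IHk v vk.
case wv : (wt v) vk => [|l] vk.
  have -> : v = 0 by apply: wt_eq0.
  split=> // _; exists 0; first by rewrite mem_head.
  by rewrite subr0.
have [a wa] := wt_pred wv; rewrite (PN a) IHk ?wa //=.
by case: (odd l); split.
Qed.

Lemma group_of_DPL6 n (C : set 'rV[int]_n) : (0 < n)%N ->
  linear_code C -> DPL_code 6 C ->
  exists (H : finGroupType) (pi : 'rV[int]_n -> H),
    [/\ forall x y, pi (x + y) = (pi x * pi y)%g,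
        forall x, pi x = 1%g -> ~~ odd (wt x) -> (wt x <= 5)%N -> x = 0,
        forall h, exists2 e, e \in even_ball n & pi e = h
      & #|H| = (2 * n ^ 2 + 1)%N].
Proof.
move=> n0 linC dplC; have trans := transversal_of_DPL6 n0 linC dplC.
have C0 := linear_code0 linC; have CB x y := @linear_codeB _ _ x y linC.
have CD x y := @linear_codeD _ _ x y linC.
have Cmin x := @DPL6_min_wt _ _ x linC dplC.
have sep : {in even_ball n &, forall e f, C (e - f) -> e = f}.
  move=> e f /even_ball_wt[we _] /even_ball_wt[wf _] Cef.
  apply/eqP; rewrite -subr_eq0; apply/eqP/Cmin => //.
  by apply: leq_trans (wtB e f) _; lia.
set m := (2 * n ^ 2 + 1)%N.
(* Translation by x permutes the classes of E modulo C. Summing e + x - f(e), which lies in C, over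
   the m elements of E leaves m x. *)
have Cm x : ~~ odd (wt x) -> C (x *+ m).
  move=> ox.
  have /choice[f fP] : forall e, exists f,
      e \in even_ball n -> f \in even_ball n /\ C (e + x - f).
    move=> e; have [ee|] := boolP (e \in even_ball n); last by exists 0.
    have [|f] := trans (e + x); last by exists f.
    by have [_ oe] := even_ball_wt ee; rewrite odd_wtD (negbTE oe) (negbTE ox).
  have fperm : perm_eq [seq f e | e <- even_ball n] (even_ball n).
    have uf : uniq [seq f e | e <- even_ball n].
      rewrite map_inj_in_uniq ?even_ball_uniq // => e e' ee e'e ff.
      apply: sep => //; have -> : e - e' = (e + x - f e) - (e' + x - f e').
        by rewrite ff !opprB addrA subrK opprD addrACA subrr addr0.
      by apply: CB; [case: (fP e ee)|case: (fP e' e'e)].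
    apply: uniq_perm => //; first exact: even_ball_uniq.
    have sub : {subset [seq f e | e <- even_ball n] <= even_ball n}.
      by move=> _ /mapP[e ee ->]; case: (fP e ee).
    by case: (uniq_min_size uf sub); rewrite ?size_map.
  suff -> : x *+ m = \sum_(e <- even_ball n) (e + x - f e).
    by rewrite big_seq; apply: (big_ind C) => // e /fP[].
  rewrite sumrB big_split /= -[\sum_(e <- _) f e](big_map f xpredT id).
  rewrite (perm_big _ fperm) /= addrAC subrr add0r.
  by rewrite big_const_seq count_predT iter_addr_0 size_even_ball.
(* As m + 1 is even, (m+1) x is always even; on even vectors, multiplication by m + 1 is the
   identity modulo C. So the even vectors of K are those of C, and each x is congruent modulo K to
   the representative in E of (m+1) x. *)
pose K : {pred 'rV[int]_n} := [pred x | x *+ m.+1 \in C].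
have KC x : x \in K -> ~~ odd (wt x) -> C x.
  rewrite !inE => Kx /Cm Cx.
  have -> : x = x *+ m.+1 - x *+ m by rewrite mulrS addrK.
  exact: CB.
have [|||H [pi [piD piE pis cH]]] :=
  @finite_zmod_quotient _ K (even_ball n) _ (even_ball_uniq n).
- split; first by rewrite !inE mul0rn.
  by move=> x y; rewrite !inE => Kx Ky; rewrite mulrnBl; apply: CB.
- move=> x; have [|e ee Ce] := trans (x *+ m.+1).
    by rewrite odd_wt_mulrn /= /m addn1 /= mul2n odd_double.
  exists e; rewrite // !inE mulrnBl [e *+ _]mulrS opprD addrA; apply: CB => //.
  by apply: Cm; case: (even_ball_wt ee).
- move=> e f ee fe Kef; apply: sep => //; apply: KC => //.
  rewrite odd_wtB.
  by case: (even_ball_wt ee) (even_ball_wt fe) => _ /negbTE -> [_ /negbTE ->].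
exists H, pi; split=> //; last by rewrite cH size_even_ball.
have pi0 : pi 0 = 1%g by apply: (mulgI (pi 0)); rewrite -piD addr0 mulg1.
by move=> x; rewrite -pi0 piE subr0 => Kx ox wx; apply: Cmin => //; apply: KC.
Qed.

(** Two sums of two unit vectors differ by an even vector of weight at most 4, so [pi] separates
    them, and counting pairs in T reduces to counting pairs of unit vectors. *)
Lemma gr_eq_of_transversal n (H : finGroupType) (pi : 'rV[int]_n -> H) :
  (0 < n)%N -> (forall x y, pi (x + y) = (pi x * pi y)%g) ->
  (forall x, pi x = 1%g -> ~~ odd (wt x) -> (wt x <= 5)%N -> x = 0) ->
  (forall h, exists2 e, e \in even_ball n & pi e = h) ->
  let T := [set pi (unitv a) | a : 'I_n * bool]%SET in
  [/\ abelian [set: H]%SET, #|T| = (2 * n)%N,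
      gr_set T = gr_pow (gr_set T) (-1)
    & gr_set T ^+ 2 = gr_set [set: H]%SET *+ 2 - gr_pow (gr_set T) 2
                      + gr_elt 1%g *+ (2 * n - 2)%N].
Proof.
move=> n0 piD sep pis T.
have pi0 : pi 0 = 1%g by apply: (mulgI (pi 0)); rewrite -piD addr0 mulg1.
have piN x : pi (- x) = (pi x)^-1%g.
  by apply: (mulgI (pi x)); rewrite -piD subrr mulgV.
have mulC (g h : H) : (g * h = h * g)%g.
  by have [x _ <-] := pis g; have [y _ <-] := pis h; rewrite -!piD addrC.
have pi_inj a b : pi (unitv a) = pi (unitv b) -> a = b.
  move=> e; apply: unitv_inj; apply/eqP; rewrite -subr_eq0; apply/eqP.
  apply: sep; first by rewrite piD piN e mulgV.
    by rewrite odd_wtB !wt_unitv.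
  by apply: leq_trans (wtB _ _) _; rewrite !wt_unitv.
have pair_inj a b c d :
    (pi (unitv a) * pi (unitv b) = pi (unitv c) * pi (unitv d))%g ->
    unitv a + unitv b = unitv c + unitv d.
  move=> e; apply/eqP; rewrite -subr_eq0; apply/eqP.
  apply: sep; first by rewrite piD piN !piD e mulgV.
    by rewrite odd_wtB !odd_wtD !wt_unitv.
  apply: leq_trans (wtB _ _) _; apply: leq_trans (leq_add (wtD _ _) (wtD _ _)) _.
  by rewrite !wt_unitv.
have inT a : pi (unitv a) \in T by apply/imsetP; exists a.
have cT : #|T| = (2 * n)%N.
  by rewrite card_imset ?card_prod ?card_ord ?card_bool 1?mulnC.
have sT g : (g^-1%g \in T) = (g \in T).
  have half h : h \in T -> h^-1%g \in T.
    by move=> /imsetP[a _ ->]; rewrite -piN -unitvN.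
  by apply/idP/idP => /half //; rewrite invgK.
split=> //; first by apply/centsP => g _ h _; apply: mulC.
  exact/gr_set_symP.
(* At 1 there are 2n ordered pairs of inverses and no square root, since 2a = 0 is impossible for a
   unit vector a. *)
apply/gr_set_sqrP => g; have [->|g1] := eqVneq g 1%g.
  have -> : [set s in T | (s^-1 * 1)%g \in T]%SET = T.
    by apply/setP => s; rewrite inE mulg1 sT andbb.
  rewrite (_ : [set s in T | (s ^+ 2)%g == 1%g]%SET = finset.set0) ?cards0.
    by rewrite cT; lia.
  apply/setP => s; rewrite !inE; apply/negP => /andP[/imsetP[a _ ->]].
  rewrite expgS expg1 -(mulgV (pi (unitv a))) -piN -unitvN => /eqP/pair_inj.
  by move=> /addrI /unitv_inj; case: a => i [].
have [x xE pix] := pis g; have [wx ox] := even_ball_wt xE.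
have [|a [b xab]] := wt_le2_even wx ox.
  by apply: contra g1 => /eqP x0; rewrite -pix x0 pi0.
have nz : unitv a + unitv b != 0 :> 'rV[int]_n.
  by apply: contra g1 => /eqP x0; rewrite -pix xab x0 pi0.
have gE : g = (pi (unitv a) * pi (unitv b))%g by rewrite -pix xab piD.
have -> : [set s in T | (s^-1 * g)%g \in T]%SET =
          [set pi (unitv a); pi (unitv b)]%SET.
  apply/setP => s; rewrite !inE; apply/andP/orP => [[/imsetP[c _ ->] /imsetP[d _ e]]|].
    have : (pi (unitv a) * pi (unitv b) = pi (unitv c) * pi (unitv d))%g.
      by rewrite -gE -e mulKVg.
    by move/pair_inj => /(unitvD_inj nz) [->|->]; rewrite eqxx; [left|right].
  case=> /eqP ->; split; rewrite ?inT // gE; first by rewrite mulKg.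
  by rewrite [(pi (unitv a) * _)%g]mulC mulKg.
rewrite cards2 muln0.
have sqE c : (pi (unitv c) ^+ 2 == g)%g = (c == a) && (c == b).
  apply/eqP/andP => [|[/eqP -> /eqP ab]]; last by rewrite gE -ab expgS expg1.
  rewrite expgS expg1 gE => /pair_inj e.
  have nzc : unitv c + unitv c != 0 :> 'rV[int]_n by rewrite e.
  have /(unitvD_inj nzc) : unitv c + unitv c = unitv b + unitv a.
    by rewrite e addrC.
  by case: (unitvD_inj nzc e) => -> [] ->; rewrite eqxx.
(* If a = b there are one ordered pair and one square root; otherwise there are two ordered pairs
   and no square root. *)
have [ab|ab] := eqVneq a b.
  rewrite ab eqxx (_ : [set s in T | _]%SET = [set pi (unitv b)]%SET) ?cards1 //.
  apply/setP => s; rewrite !inE; apply/andP/eqP => [[/imsetP[c _ ->]]|->].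
    by rewrite sqE => /andP[_ /eqP ->].
  by rewrite inT sqE ab eqxx.
rewrite (_ : (_ != _)); last by apply: contra ab => /eqP/pi_inj ->.
rewrite (_ : [set s in T | _]%SET = finset.set0) ?cards0 //.
apply/setP => s; rewrite !inE; apply/negP => /andP[/imsetP[c _ ->]].
by rewrite sqE => /andP[/eqP ->]; rewrite (negbTE ab).
Qed.

Theorem theorem4 (n : nat) (hn : (3 <= n)%N) :
  (exists C : set 'rV[int]_n, linear_code C /\ DPL_code 6 C) <->
  (exists (H : finGroupType) (T : {set H}),
     (abelian [set: H]%SET /\ #|H| = (2 * n ^ 2 + 1)%N) /\
     [/\ #|T| = (2 * n)%N,
         gr_set T = gr_pow (gr_set T) (-1)
       & gr_set T ^+ 2 =
           gr_set [set: H]%SET *+ 2 - gr_pow (gr_set T) 2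
             + gr_elt 1%g *+ (2 * n - 2)%N]).
Proof.
have n0 : (0 < n)%N by apply: leq_trans hn.
split=> [[C [linC dplC]]|[H [T [[abH _] [cT sT sqT]]]]]; last first.
  exact: (code_of_group n0 abH cT sT sqT).
have [H [pi [piD sep pis cH]]] := group_of_DPL6 n0 linC dplC.
have [abH cT sT sqT] := gr_eq_of_transversal n0 piD sep pis.
by exists H, [set pi (unitv a) | a : 'I_n * bool]%SET.
Qed.
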